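(* For every real $C>0$ there is a constant $K=K(C)>0$ such that the following holds. Let $n$ be a positive integer, and let $A \subseteq \mathbb{R}_{>0}$ be an $n$-element set with $|\mathrm{FS}(A)| \leq Cn^2$. Then there is a decomposition $A=A_1 \sqcup A_2$ (disjoint union) such that: (i) there is some $r \in \mathbb{R}_{>0}$ with $A_1 \subseteq r\cdot\mathbb{Z}_{>0}$ and $\sum_{x \in r^{-1}\cdot A_1}x \leq K n^2$; and (ii) $|A_2|\leq K$.
   Context: For a finite subset $A$ of an abelian group, $\mathrm{FS}(A):=\{\sum_{x\in B}x : B\subseteq A\}$ is the set of subset sums of $A$ (the empty subset gives $0$). For a nonzero real $c$ and a set $X$ of reals, $c\cdot X:=\{cx: x\in X\}$. *)

(* Defs.v *)
From mathcomp Require Import all_boot all_order all_algebra.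
From mathcomp Require Import finmap.
From mathcomp Require Import mathcomp_extra boolp classical_sets functions.
From mathcomp Require Import cardinality fsbigop reals.

Set Implicit Arguments.
Unset Strict Implicit.
Unset Printing Implicit Defensive.

Import Order.TTheory GRing.Theory Num.Theory.
Local Open Scope fset_scope.
Local Open Scope classical_set_scope.
Local Open Scope ring_scope.

Definition FS (V : zmodType) (A : {fset V}) : {fset V} :=
  [fset (\sum_(x <- (B : {fset V})) x) | B in fpowerset A].

Definition dilate (R : realType) (c : R) (X : set R) : set R :=
  [set c * x | x in X].

Definition pos_integers (R : realType) : set R :=
  [set m%:~R | m in [set m : int | 0 < m]].
Arguments pos_integers R : clear implicits.

(* Main.v *)
Require Import Defs.
From mathcomp Require Import all_boot all_order all_algebra.
From mathcomp Require Import finmap.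
From mathcomp Require Import mathcomp_extra boolp classical_sets functions.
From mathcomp Require Import cardinality fsbigop reals.
From mathcomp Require Import zify ring lra.

Set Implicit Arguments.
Unset Strict Implicit.
Unset Printing Implicit Defensive.

Import Order.TTheory GRing.Theory Num.Theory.
Local Open Scope fset_scope.
Local Open Scope ring_scope.

(** The sumset [FS B] of part of [A] is hardly moved by translation by most
    elements of [A], and a set of small translations generates so few reals
    that it must sit in a short progression.

    In detail, let [A] have about [n] elements and [#|FS A| <= c n^2]. Adjoining
    [a] to [B] enlarges [FS B] by at least [escape (FS B) a], the number of
    points of [FS B] that translation by [a] throws out of [FS B]. The total
    growth is at most [c n^2], so a maximality argument
    ([exists_almost_periods]) gives a [B], with [S = FS B] of size of order
    [n^2], such that a positive proportion [E] of [A] has escape [O(n)] from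
    [S]. Escape is even and subadditive, so a combination of at most [k] elements
    of [E] and [-E] still has escape at most [#|S| / 2] for some [k] of order
    [n]; by double counting at most [2 #|S|] reals have this property
    ([card_almost_periods]). So the [k]-fold ball spanned by [E] has only
    [O(n^2)] elements.

    Let [M] be the largest element of [E]. Translates by multiples of [M] show
    that the [k/2]-fold ball has [O(n)] residues modulo [M]. As long as the balls
    keep growing modulo [M], every third step adds [#|E|] new residues
    ([card_ball_growth]), so the growth stops after boundedly many steps. At that
    point the [h = O(n)] residues of the ball are permuted by translation by each
    [e] in [E], and summing them gives [h e] in [M Z] ([residue_stable]). Hence
    [E] lies in [{r, 2r, ..., hr}] with [r = M / h]
    ([almost_periods_in_progression]).

    It remains to treat [W = A \ E]. As [FS E] lies in [r Z] and has order [n^2]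
    elements, [FS W] meets boundedly many classes modulo [r]. A set [T] in [W]
    for which [FS T] meets more than [#|T|] classes is therefore bounded, and when
    it is largest all other elements permute the classes of [FS T]; so they lie
    in [(r/h') Z] for a bounded [h'] ([complement_in_progression]). Finally let [D]
    of order [r n^2] bound the sum of [E]. Each subset of [W \ T] of sum beyond
    [D] yields a translate of [FS E] disjoint from the previous ones, so only
    boundedly many elements exceed [D] and the others have sum [O(D)]
    ([card_FS_truncated_sum]). The exceptional set consists of [T] and the
    elements beyond [D]. *)

(** * Finite sets *)

Lemma card_injS (T T' : choiceType) (f : T -> T') (X : {fset T})
    (Y : {fset T'}) :
    {in X &, injective f} -> (forall x, x \in X -> f x \in Y) ->
  (#|` X| <= #|` Y|)%N.
Proof.
move=> injf fXY; rewrite -(card_in_imfset imfset_key injf).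
by apply/fsubset_leq_card/fsubsetP=> _ /imfsetP[x /= xX ->]; exact: fXY.
Qed.

Lemma card_fsetU_disj (K : choiceType) (X Y : {fset K}) :
  [disjoint X & Y] -> #|` X `|` Y| = (#|` X| + #|` Y|)%N.
Proof. by rewrite cardfsU -fsetI_eq0 => /eqP->; rewrite cardfs0 subn0. Qed.

Lemma card_fsetM (K K' : choiceType) (X : {fset K}) (Y : {fset K'}) :
  #|` X `*` Y| = (#|` X| * #|` Y|)%N.
Proof.
rewrite card_fset_sum1 big_imfset2 /=; last by move=> [x y] [x' y'] _ _ /= [-> ->].
under eq_bigr do rewrite -card_fset_sum1 -[#|` Y|]mul1n.
by rewrite -big_distrl /= -card_fset_sum1.
Qed.

Lemma exists_fsub_card (K : choiceType) (A : {fset K}) (k : nat) :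
  (k <= #|` A|)%N -> exists2 B, B `<=` A & #|` B| = k.
Proof.
elim: k => [|k IH] kA; first by exists fset0; rewrite ?cardfs0.
have [B BA Bk] := IH (ltnW kA).
have: A `\` B != fset0 by rewrite -cardfs_gt0 cardfsDS// Bk; lia.
case/fset0Pn=> x; rewrite in_fsetD => /andP[xB xA].
exists (x |` B); first by rewrite fsubUset fsub1set xA.
by rewrite cardfsU1 xB Bk.
Qed.

Lemma exists_max_fsub (K : choiceType) (A : {fset K}) (P : {fset K} -> Prop)
    (B0 : {fset K}) :
    B0 `<=` A -> P B0 ->
  exists B, [/\ B `<=` A, P B &
    forall B', B' `<=` A -> P B' -> (#|` B'| <= #|` B|)%N].
Proof.
move=> B0A PB0.
pose Q k := `[< exists B, [/\ B `<=` A, P B & #|` B| = k] >].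
have exQ : exists k, Q k by exists #|` B0|; apply/asboolP; exists B0.
have ubQ k : Q k -> (k <= #|` A|)%N.
  by move=> /asboolP[B [BA _ <-]]; exact: fsubset_leq_card.
case: (ex_maxnP exQ ubQ) => k /asboolP[B [BA PB Bk]] kmax.
exists B; split=> // B' B'A PB'; rewrite Bk; apply: kmax.
by apply/asboolP; exists B'.
Qed.

Lemma big_fsetU_disj (V : nmodType) (K : choiceType) (A B : {fset K})
    (F : K -> V) : [disjoint A & B] ->
  \sum_(x <- A `|` B) F x = \sum_(x <- A) F x + \sum_(x <- B) F x.
Proof.
move=> dAB; rewrite (big_fsetID _ (mem A)) /=; congr (_ + _).
  by apply: eq_fbigl => x; rewrite !inE /=; case: (x \in A); rewrite ?andbF.
apply: eq_fbigl => x; rewrite !inE /=; case: (boolP (x \in A)) => //= xA.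
  by rewrite (negbTE (fdisjointP dAB _ xA)).
by rewrite andbT.
Qed.

(** * Sumsets, balls and subset sums *)

Section Sumsets.
Variable V : zmodType.
Implicit Types (X Y S U A B : {fset V}) (a b x y : V).

Definition sumset X Y : {fset V} := [fset x + y | x in X, y in Y].

Lemma sumsetP X Y z :
  reflect (exists x y, [/\ x \in X, y \in Y & z = x + y]) (z \in sumset X Y).
Proof.
apply: (iffP (imfset2P _ _ _ _ _)) => [[x /= xX [y /= yY ->]]|[x [y [xX yY ->]]]].
  by exists x, y.
by exists x => //=; exists y.
Qed.

Lemma mem_sumset X Y x y : x \in X -> y \in Y -> x + y \in sumset X Y.
Proof. by move=> xX yY; apply/sumsetP; exists x, y. Qed.

Lemma sumset_subl X Y : 0 \in Y -> X `<=` sumset X Y.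
Proof.
by move=> Y0; apply/fsubsetP=> x xX; rewrite -[x]addr0; exact: mem_sumset.
Qed.

(** For a symmetric [U] containing 0, this is the ball of radius [k] in the
    Cayley graph on the generators [U]. *)
Fixpoint ball U k : {fset V} :=
  if k is j.+1 then sumset (ball U j) U else [fset 0].

Lemma ball_le U j k : 0 \in U -> (j <= k)%N -> ball U j `<=` ball U k.
Proof.
move=> U0; elim: k => [|k IH]; first by rewrite leqn0 => /eqP->.
rewrite leq_eqVlt => /predU1P[->//|/IH jk].
by apply: (fsubset_trans jk); exact: sumset_subl.
Qed.

Lemma ballD U j k x y :
  x \in ball U j -> y \in ball U k -> x + y \in ball U (j + k).
Proof.
elim: k y => [|k IH] y xB /=; first by rewrite inE => /eqP->; rewrite addr0 addn0.
case/sumsetP=> [z [u [zB uU ->]]]; rewrite addrA addnS.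
by apply: mem_sumset => //; exact: IH.
Qed.

Lemma ball_muln U k u i : 0 \in U -> u \in U -> (i <= k)%N ->
  u *+ i \in ball U k.
Proof.
move=> U0 uU ik; apply: (fsubsetP (ball_le U0 ik)).
elim: i {ik} => [|i IH]; first by rewrite mulr0n inE.
by rewrite mulrSr; exact: mem_sumset.
Qed.

Definition symfset A : {fset V} := 0 |` (A `|` [fset - x | x in A]).

Lemma symfset0 A : 0 \in symfset A. Proof. by rewrite !inE eqxx. Qed.

Lemma symfsetN A x : x \in symfset A -> - x \in symfset A.
Proof.
rewrite !inE => /orP[/eqP->|/orP[xA|/imfsetP[y /= yA ->]]].
- by rewrite oppr0 eqxx.
- by apply/orP; right; apply/orP; right; apply/imfsetP; exists x.
- by rewrite opprK yA orbT.
Qed.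

Lemma symfset_sub A : A `<=` symfset A.
Proof. by apply/fsubsetP=> x xA; rewrite !inE xA orbT. Qed.

Lemma FSP A z :
  reflect (exists2 B : {fset V}, B `<=` A & z = \sum_(x <- B) x) (z \in FS A).
Proof.
apply: (iffP (imfsetP _ _ _ _)) => [[B /= BA ->]|[B BA ->]].
  by exists B; rewrite // -fpowersetE.
by exists B; rewrite //= fpowersetE.
Qed.

Lemma sum_in_FS A B : B `<=` A -> \sum_(x <- B) x \in FS A.
Proof. by move=> BA; apply/FSP; exists B. Qed.

Lemma FS0 A : 0 \in FS A.
Proof. by have := sum_in_FS (fsub0set A); rewrite big_seq_fset0. Qed.

Lemma mem_FS a A : a \in A -> a \in FS A.
Proof.
move=> aA; have aA' : [fset a] `<=` A by rewrite fsub1set.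
by have := sum_in_FS aA'; rewrite big_seq_fset1.
Qed.

Lemma FS_mono A B : A `<=` B -> FS A `<=` FS B.
Proof.
move=> AB; apply/fsubsetP=> _ /FSP[X XA ->]; apply: sum_in_FS.
exact: fsubset_trans AB.
Qed.

Lemma mem_FSU A B a b : [disjoint A & B] ->
  a \in FS A -> b \in FS B -> a + b \in FS (A `|` B).
Proof.
move=> dAB /FSP[X XA ->] /FSP[Y YB ->]; rewrite -big_fsetU_disj.
  by apply: sum_in_FS; exact: fsetUSS.
apply: (fdisjointWl XA); rewrite fdisjoint_sym.
by apply: (fdisjointWl YB); rewrite fdisjoint_sym.
Qed.

Lemma sumset_FS A B : [disjoint A & B] ->
  sumset (FS A) (FS B) `<=` FS (A `|` B).
Proof.
move=> dAB; apply/fsubsetP=> _ /sumsetP[a [b [aA bB ->]]]; exact: mem_FSU.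
Qed.

(** * Almost periods *)

(** This measures how far [a] is from being a period of [S]; on elements of the
    group it behaves like a length, by [escape0], [escapeN] and [escapeD]. *)
Definition escape S a := #|` [fset s in S | s + a \notin S]|.

Lemma card_return S a :
  (#|` [fset s in S | (s + a)%R \in S]| + escape S a = #|` S|)%N.
Proof.
rewrite -(cardfsID [fset s in S | s + a \in S] S) /escape; congr (_ + _)%N.
  by congr #|` _|; apply/fsetP=> s; rewrite !inE /= andbA andbb.
congr #|` _|; apply/fsetP=> s; rewrite !inE /=.
by case: (s \in S); rewrite /= ?andbF ?andbT.
Qed.

Lemma escape0 S : escape S 0 = 0%N.
Proof.
apply/eqP; rewrite cardfs_eq0; apply/eqP/fsetP=> s; rewrite !inE /= addr0.
by case: (s \in S).
Qed.

(** The points of [S] that stay in [S] under translation by [a] and by [- a] are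
    the two ends of the pairs of [S] with difference [a]. *)
Lemma escapeN S a : escape S (- a) = escape S a.
Proof.
suff H b : (#|` [fset s in S | (s + b)%R \in S]| <=
            #|` [fset s in S | (s - b)%R \in S]|)%N.
  have := H a; have := H (- a); have := card_return S a.
  have := card_return S (- a); rewrite opprK; lia.
apply: (card_injS (f := +%R^~ b)) => [x y _ _ /addIr//|x].
by rewrite !inE /= addrK => /andP[-> ->].
Qed.

(** A point lost under translation by [a + b] is lost in the first step or in the
    second. *)
Lemma escapeD S a b : (escape S (a + b) <= escape S a + escape S b)%N.
Proof.
pose Y := [fset s in S | (s + a \in S) && (s + a + b \notin S)].
have YS : (#|` Y| <= escape S b)%N.
  apply: (card_injS (f := +%R^~ a)) => [x y _ _ /addIr//|x].
  by rewrite !inE /= => /and3P[_ -> ->].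
apply: (leq_trans _ (leq_add (leqnn _) YS)).
pose Z := [fset s in S | s + a \notin S].
rewrite /escape -/Z; apply: (@leq_trans #|` Z `|` Y|); last first.
  by rewrite cardfsU leq_subr.
apply/fsubset_leq_card/fsubsetP=> s; rewrite !inE /= addrA.
by case/andP=> -> ->; case: (s + a \in S).
Qed.

Lemma escape_ball S E t k x :
    (forall e, e \in E -> (escape S e <= t)%N) ->
  x \in ball (symfset E) k -> (escape S x <= k * t)%N.
Proof.
move=> Et; elim: k x => [|k IH] x /=; first by rewrite inE => /eqP->; rewrite escape0.
case/sumsetP=> [y [u [yB uU ->]]]; apply: leq_trans (escapeD _ _ _) _.
rewrite mulSn addnC; apply: leq_add; last exact: IH.
move: uU; rewrite !inE => /orP[/eqP->|/orP[/Et//|/imfsetP[e /= eE ->]]].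
  by rewrite escape0.
by rewrite escapeN Et.
Qed.

Lemma card_sep (K : choiceType) (X : {fset K}) (P : pred K) :
  #|` [fset s in X | P s]| = (\sum_(s <- X) P s)%N.
Proof.
rewrite card_fset_sum1 big_fset big_mkcond /=.
by apply: eq_bigr => i; case: (P i).
Qed.

(** Each [x] in [X] is the difference of at least [#|S| / 2] pairs from [S],
    and only [#|S| ^ 2] pairs are available. *)
Lemma card_almost_periods S X : S != fset0 ->
    (forall x, x \in X -> (2 * escape S x <= #|` S|)%N) ->
  (#|` X| <= 2 * #|` S|)%N.
Proof.
rewrite -cardfs_gt0 => S0 HX.
have H1 : (#|` X| * #|` S| <=
    \sum_(x <- X) 2 * #|` [fset s in S | (s + x)%R \in S]|)%N.
  rewrite (card_fset_sum1 X) big_distrl /= !big_seq; apply: leq_sum => x xX.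
  rewrite mul1n -(leq_add2r (2 * escape S x)) -mulnDr card_return.
  by rewrite [leqRHS]mul2n -addnn leq_add2l; exact: HX.
have H2 : (\sum_(x <- X) 2 * #|` [fset s in S | (s + x)%R \in S]|
           <= 2 * (#|` S| * #|` S|))%N.
  rewrite -big_distrr /= leq_pmul2l//.
  under eq_bigr do rewrite card_sep.
  rewrite exchange_big /= {1}(card_fset_sum1 S) big_distrl /=.
  rewrite [leqLHS]big_seq [leqRHS]big_seq.
  apply: leq_sum => s sS; rewrite mul1n -card_sep.
  apply: (card_injS (f := +%R s)) => [x y _ _ /addrI//|x].
  by rewrite !inE => /andP[].
by have := leq_trans H1 H2; rewrite mulnA leq_pmul2r.
Qed.

(** * Counting classes modulo a subgroup *)

(** In this section [f] stands for reduction modulo a subgroup. *)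
Section Classes.
Variables (T : choiceType) (f : V -> T).

(** The translates of [Y] by representatives of distinct classes are
    disjoint. *)
Lemma card_sumset_fibers X Y :
    (forall x y, y \in Y -> f (x + y) = f x) ->
  (#|` f @` X| * #|` Y| <= #|` sumset X Y|)%N.
Proof.
move=> fY.
(* [g] picks a representative in [X] of each class met by [X]. *)
have /choice[g gP] c : exists x, c \in f @` X -> x \in X /\ f x = c.
  case: (boolP (c \in f @` X)) => [/imfsetP[x /= xX ->]|_]; last by exists 0.
  by exists x.
rewrite -card_fsetM.
apply: (card_injS (f := fun u => g u.1 + u.2)) => [[c y] [c' y']|[c y]] /=.
  rewrite !in_fsetM /= => /andP[cX yY] /andP[cX' yY'] e.
  have [[_ gc] [_ gc']] := (gP _ cX, gP _ cX').
  have cc' : c = c' by rewrite -gc -gc' -(fY _ _ yY) e fY.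
  by move: e; rewrite cc' => /addrI->.
by rewrite in_fsetM /= => /andP[cX yY]; apply: mem_sumset; case: (gP _ cX).
Qed.

Hypothesis fD : forall x y z, f x = f y -> f (x + z) = f (y + z).

(** A class [y] at distance exactly [3 i + 2] has its whole neighbourhood [y + E]
    inside the ball of radius [3 i + 3] and outside the one of radius [3 i], so
    three steps of strict growth gain [#|E|] classes. *)
Lemma card_ball_growth U E i :
    0 \in U -> (forall u, u \in U -> - u \in U) -> E `<=` U ->
    {in E &, injective f} ->
    (forall l, (l < 3 * i)%N -> ~~ (f @` ball U l.+1 `<=` f @` ball U l)) ->
  (i * #|` E| <= #|` f @` ball U (3 * i)|)%N.
Proof.
move=> U0 UN EU injf; elim: i => [|i IH] grow; first by rewrite mul0n.
have {}IH := IH (fun l li => grow l (ltn_trans li _)).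
rewrite mulSn (_ : 3 * i.+1 = (3 * i).+3)%N; last lia.
have /fsubsetPn[_ /imfsetP[/= y yB ->] yNB] : 
    ~~ (f @` ball U (3 * i).+2 `<=` f @` ball U (3 * i).+1) by apply: grow; lia.
pose Y := [fset y + e | e in E].
have Ycard : #|` f @` Y| = #|` E|.
  rewrite -imfset_comp card_in_imfset// => a b aE bE /= eab; apply: injf => //.
  by have := fD (- y) eab; rewrite ![y + _]addrC !addrK.
have YB : f @` Y `<=` f @` ball U (3 * i).+3.
  apply: subset_imfset => _ /imfsetP[e /= eE ->].
  by apply: mem_sumset => //; exact: (fsubsetP EU).
have BB : f @` ball U (3 * i) `<=` f @` ball U (3 * i).+3.
  by apply: subset_imfset; apply/fsubsetP/ball_le => //; lia.
have dis : [disjoint f @` Y & f @` ball U (3 * i)].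
  apply/fdisjointP=> _ /imfsetP[/= _ /imfsetP[e /= eE ->] ->].
  apply: contra yNB => /imfsetP[/= z zB eyz].
  apply/imfsetP; exists (z - e) => /=.
    by apply: mem_sumset => //; apply/UN/(fsubsetP EU).
  by have := fD (- e) eyz; rewrite addrK.
rewrite -{1}Ycard; apply: (@leq_trans #|` f @` Y `|` f @` ball U (3 * i)|).
  by rewrite card_fsetU_disj// leq_add2l IH//; lia.
by apply: fsubset_leq_card; rewrite fsubUset YB.
Qed.

End Classes.
End Sumsets.

(** * Subset sums of positive reals *)

Section Reals.
Variable R : realType.
Implicit Types (A B E F X Y T : {fset R}) (r x y z D M : R).

Lemma exists_fset_max A : A != fset0 ->
  exists2 a, a \in A & forall b, b \in A -> b <= a.
Proof.
elim/finSet_rect: A => A IH /fset0Pn[a aA].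
have [A1|/IH[|b]] := eqVneq (A `\ a) fset0.
- exists a => // b bA; have := in_fset0 b.
  by rewrite -A1 !inE bA andbT => /negbFE/eqP->.
- exact: fproperD1.
rewrite !inE => /andP[_ bA] bmax.
have [ab|/ltW ba] := leP a b.
  exists b => // c cA; have [->//|ca] := eqVneq c a.
  by apply: bmax; rewrite !inE ca.
exists a => // c cA; have [->//|ca] := eqVneq c a.
by apply: le_trans ba; apply: bmax; rewrite !inE ca.
Qed.

Lemma sum_fset_ge0 A : (forall x, x \in A -> 0 < x) -> 0 <= \sum_(x <- A) x.
Proof. by move=> A0; rewrite big_seq sumr_ge0// => x /A0/ltW. Qed.

Lemma sum_fset_sub A B : (forall x, x \in A -> 0 < x) -> B `<=` A ->
  \sum_(x <- B) x <= \sum_(x <- A) x.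
Proof.
move=> A0 BA; rewrite [leRHS](big_fsetID _ (mem B)) /=.
rewrite (_ : [fset x | x in A & x \in B] = B); last first.
  apply/fsetP=> x; rewrite !inE /=; case: (boolP (x \in B)); rewrite ?andbF// andbT.
  by move=> /(fsubsetP BA).
by rewrite lerDl sum_fset_ge0// => x; rewrite !inE => /andP[/A0].
Qed.

Lemma FS_bounds A z : (forall x, x \in A -> 0 < x) -> z \in FS A ->
  0 <= z <= \sum_(x <- A) x.
Proof.
move=> A0 /FSP[B BA ->]; rewrite sum_fset_sub// andbT sum_fset_ge0// => x xB.
exact/A0/(fsubsetP BA).
Qed.

(** Removing the largest element [a], the sums that omit at most one element of
    [A], and not [a], all exceed the total of the rest: each step gains
    [#|A|]. *)
Lemma card_FS_ge A : (forall x, x \in A -> 0 < x) ->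
  (#|` A| ^ 2 <= 2 * #|` FS A|)%N.
Proof.
elim/finSet_rect: A => A IH A0.
have [->|/exists_fset_max[a aA amax]] := eqVneq A fset0.
  by rewrite cardfs0 exp0n.
set A' := A `\ a; have A'0 x : x \in A' -> 0 < x.
  by rewrite !inE => /andP[_ /A0].
have {}IH := IH A' (fproperD1 aA) A'0.
have cA : #|` A| = #|` A'|.+1 by rewrite (cardfsD1 a A) aA.
have sA : \sum_(x <- A) x = a + \sum_(x <- A') x by exact: big_fsetD1.
pose N := [fset \sum_(x <- A) x - b | b in 0 |` A'].
have cN : #|` N| = #|` A|.
  rewrite card_in_imfset => [|x y _ _ /addrI/oppr_inj//].
  by rewrite cardfsU1 cA; case: (boolP (0 \in A')) => // /A'0; rewrite ltxx.
have NA : N `<=` FS A.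
  apply/fsubsetP => _ /imfsetP[b /= + ->].
  rewrite inE inE => /orP[/eqP->|]; first by rewrite subr0 sum_in_FS.
  rewrite !inE => /andP[_ bA]; rewrite (big_fsetD1 b)//= addrAC subrr add0r.
  by apply: sum_in_FS; exact: fsubD1set.
have dN : [disjoint FS A' & N].
  apply/fdisjointP=> z /(FS_bounds A'0)/andP[_ zA']; apply/negP.
  move=> /imfsetP[b /= bA' ez]; move: zA'; rewrite ez sA; apply/negP.
  rewrite -ltNge -subr_gt0 (_ : _ - _ = a - b); last ring.
  rewrite subr_gt0; move: bA'; rewrite !inE => /orP[/eqP->|/andP[ba bA]].
    exact: A0.
  by rewrite lt_neqAle ba amax.
have : (#|` FS A'| + #|` N| <= #|` FS A|)%N.
  rewrite -card_fsetU_disj//; apply/fsubset_leq_card.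
  by rewrite fsubUset NA FS_mono// fsubD1set.
rewrite cN cA; move: IH; nia.
Qed.

(** * Residues modulo [r] *)

Definition residue r x := x - r * (Num.floor (x / r))%:~R.

Lemma residueDint r x (m : int) : 0 < r -> residue r (x + r * m%:~R) = residue r x.
Proof.
move=> r0; rewrite /residue mulrDl [r * _ / r]mulrAC divff ?gt_eqF// mul1r.
rewrite floorDrz ?intr_int// intrKfloor intrD; ring.
Qed.

Lemma residue_eqP r x y : 0 < r ->
  residue r x = residue r y <-> exists m : int, x = y + r * m%:~R.
Proof.
move=> r0; split=> [|[m ->]]; last exact: residueDint.
move=> e; exists (Num.floor (x / r) - Num.floor (y / r)).
by rewrite intrB mulrBr; move: e; rewrite /residue; lra.
Qed.

Lemma residueD r x y z : 0 < r ->
  residue r x = residue r y -> residue r (x + z) = residue r (y + z).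
Proof.
by move=> r0 /residue_eqP-/(_ r0)[m ->]; rewrite addrAC residueDint.
Qed.

Lemma residue_id r x : 0 < r -> residue r (residue r x) = residue r x.
Proof.
move=> r0; apply/residue_eqP => //; exists (- Num.floor (x / r)).
by rewrite intrN mulrN.
Qed.

(** Translation by [x] permutes the classes of [F]; compare the sums of all
    the classes before and after. *)
Lemma residue_stable r F x : 0 < r ->
    (forall y, y \in F -> residue r (y + x) \in residue r @` F) ->
  exists m : int, x *+ #|` residue r @` F| = r * m%:~R.
Proof.
move=> r0 Fx; set G := residue r @` F.
have GG : [fset residue r (g + x) | g in G] = G.
  apply/eqP; rewrite eqEfcard; apply/andP; split.
    apply/fsubsetP=> _ /imfsetP[/= _ /imfsetP[y /= yF ->] ->].
    by rewrite (residueD _ r0 (residue_id y r0)) Fx.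
  rewrite [leqRHS]card_in_imfset// => _ _ /imfsetP[y /= yF ->] /imfsetP[z /= zF ->] e.
  rewrite -[LHS]residue_id// -[RHS]residue_id//.
  by have := residueD (- x) r0 e; rewrite !addrK.
pose k := \sum_(g <- G) Num.floor ((g + x) / r).
exists k; rewrite /k (big_morph (@intmul R 1) (@intrD R) (erefl _)) big_distrr /=.
have : \sum_(g <- G) residue r (g + x) = \sum_(g <- G) g.
  rewrite -[in RHS]GG [RHS]big_imfset//=.
  move=> _ _ /imfsetP[y /= yF ->] /imfsetP[z /= zF ->] e.
  rewrite -[LHS]residue_id// -[RHS]residue_id//.
  by have := residueD (- x) r0 e; rewrite !addrK.
rewrite /residue sumrB big_split /=.
rewrite (_ : \sum_(g <- G) x = x *+ #|` G|); first by lra.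
by rewrite big_const_seq count_predT iter_addr_0.
Qed.

(** * Disjoint translates of a set of subset sums *)

(** Take [Y] minimal with sum above [D]: for any [a] in [Y], the rest of [Y] has
    sum at most [D], and the truncation of [a] is also at most [D]. *)
Lemma exists_heavy_fsub X D : 0 <= D -> D < \sum_(x <- X) x ->
  exists Y, [/\ Y `<=` X, D < \sum_(x <- Y) x &
               \sum_(x <- Y) Num.min x D <= 2 * D].
Proof.
move=> D0; elim/finSet_rect: X => X IH DX.
have [X0|/fset0Pn[a aX]] := eqVneq X fset0.
  by move: DX; rewrite X0 big_seq_fset0; lra.
have [DX'|XD'] := ltP D (\sum_(x <- X `\ a) x).
  have [Y [YX' DY YD]] := IH _ (fproperD1 aX) DX'.
  by exists Y; split=> //; apply: fsubset_trans YX' _; exact: fsubD1set.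
exists X; split=> //; rewrite (big_fsetD1 a)//=.
have : \sum_(x <- X `\ a) Num.min x D <= \sum_(x <- X `\ a) x.
  by apply: ler_sum => x _; rewrite ge_min lexx.
have : Num.min a D <= D by rewrite ge_min lexx orbT.
lra.
Qed.

(** Adding the sum of [Y] moves the subset sums of [E] and [X \ Y] beyond all
    those of [E]. *)
Lemma card_FS_heavy E X Y :
    (forall x, x \in E `|` X -> 0 < x) -> [disjoint E & X] -> Y `<=` X ->
    \sum_(x <- E) x < \sum_(x <- Y) x ->
  (#|` FS E| + #|` FS (E `|` (X `\` Y))| <= #|` FS (E `|` X)|)%N.
Proof.
move=> pos dEX YX EY; set Z := E `|` (X `\` Y).
have E0 x : x \in E -> 0 < x by move=> xE; apply: pos; rewrite inE xE.
have Z0 x : x \in Z -> 0 < x.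
  by rewrite !inE => /orP[xE|/andP[_ xX]]; apply: pos; rewrite inE ?xE ?xX ?orbT.
have dYZ : [disjoint Y & Z].
  apply/fdisjointP=> x xY; rewrite !inE xY /= orbF.
  move: dEX; rewrite fdisjoint_sym => /fdisjointP; apply; exact: (fsubsetP YX).
have YZ : Y `|` Z = E `|` X.
  apply/fsetP=> x; rewrite !inE; case: (boolP (x \in Y)) => //= /(fsubsetP YX)->.
  by rewrite orbT.
pose s := \sum_(x <- Y) x.
have -> : #|` FS Z| = #|` [fset s + z | z in FS Z]|.
  by rewrite [RHS]card_in_imfset// => x y _ _ /addrI.
rewrite -card_fsetU_disj.
  apply/fsubset_leq_card; rewrite fsubUset FS_mono ?fsubsetUl//=.
  apply/fsubsetP=> _ /imfsetP[z /= zZ ->]; rewrite -YZ.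
  by apply: mem_FSU => //; exact: sum_in_FS.
apply/fdisjointP=> z /(FS_bounds E0)/andP[_ zE]; apply/negP=> /imfsetP[w /=].
move=> /(FS_bounds Z0)/andP[w0 _] e; move: zE; rewrite e /s; lra.
Qed.

(** Peel off from [X] subsets of sum above [D] and truncated sum at most [2 D]:
    each one contributes a new disjoint translate of [FS E]. Truncating the
    elements at [D] makes one inequality control both the number of the large
    ones and the sum of the small ones. *)
Lemma card_FS_truncated_sum E X D :
    (forall x, x \in E `|` X -> 0 < x) -> [disjoint E & X] ->
    \sum_(x <- E) x <= D ->
  (#|` FS E|)%:R * \sum_(x <- X) Num.min x D
    <= 2 * D * (#|` FS (E `|` X)|)%:R.
Proof.
elim/finSet_rect: X => X IH pos dEX ED.
have E0 x : x \in E -> 0 < x by move=> xE; apply: pos; rewrite inE xE.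
have D0 : 0 <= D by apply: le_trans ED; exact: sum_fset_ge0.
have [DX|XD] := ltP D (\sum_(x <- X) x); last first.
  have mX : \sum_(x <- X) Num.min x D <= D.
    by apply: le_trans XD; apply: ler_sum => x _; rewrite ge_min lexx.
  have : (#|` FS E|)%:R <= (#|` FS (E `|` X)|)%:R :> R.
    by rewrite ler_nat fsubset_leq_card// FS_mono// fsubsetUl.
  move=> /(ler_wpM2l D0); have := ler_wpM2l (ler0n R #|` FS E|) mX.
  have := mulr_ge0 D0 (ler0n R #|` FS (E `|` X)|); lra.
have [Y [YX DY YD]] := exists_heavy_fsub D0 DX.
have Yn0 : Y != fset0.
  by apply/eqP=> Y0; move: DY; rewrite Y0 big_seq_fset0; lra.
have X'X : X `\` Y `<` X.
  rewrite fproperEcard fsubsetDl /= cardfsDS//.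
  have Y0 : (0 < #|` Y|)%N by rewrite cardfs_gt0.
  by rewrite ltn_subrL Y0; apply: leq_trans Y0 _; exact: fsubset_leq_card.
have {}IH : (#|` FS E|)%:R * \sum_(x <- X `\` Y) Num.min x D
    <= 2 * D * (#|` FS (E `|` (X `\` Y))|)%:R.
  apply: IH => // [x|].
    rewrite !inE => /orP[xE|/andP[_ xX]]; apply: pos; by rewrite inE ?xE ?xX ?orbT.
  rewrite fdisjoint_sym; apply: (fdisjointWl (fsubsetDl _ _)).
  by rewrite fdisjoint_sym.
have hv : (#|` FS E|)%:R + (#|` FS (E `|` (X `\` Y))|)%:R
    <= (#|` FS (E `|` X)|)%:R :> R.
  by rewrite -natrD ler_nat card_FS_heavy// (le_lt_trans ED).
have -> : \sum_(x <- X) Num.min x D =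
    \sum_(x <- Y) Num.min x D + \sum_(x <- X `\` Y) Num.min x D.
  rewrite -big_fsetU_disj; last first.
    by apply/fdisjointP=> x xY; rewrite !inE xY.
  congr (\sum_(x <- enum_fset _) _); apply/fsetP=> x; rewrite !inE.
  by case: (boolP (x \in Y)) => //= /(fsubsetP YX)->.
have := ler_wpM2l (ler0n R #|` FS E|) YD.
have := ler_wpM2l D0 hv; lra.
Qed.

End Reals.

(** * Many almost periods lie in a short progression *)

Section Structure.
Variable R : realType.
Implicit Types (A B E F X Y T S : {fset R}) (r x y z D M : R).

Lemma card_FS_U1 a B : a \notin B ->
  (#|` FS B| + escape (FS B) a <= #|` FS (a |` B)|)%N.
Proof.
move=> aB; pose Z := [fset s in FS B | s + a \notin FS B].
have -> : escape (FS B) a = #|` [fset s + a | s in Z]|.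
  by rewrite [RHS]card_in_imfset// => x y _ _ /addIr.
rewrite -card_fsetU_disj; last first.
  rewrite fdisjoint_sym; apply/fdisjointP=> _ /imfsetP[s /= + ->].
  by rewrite !inE => /andP[].
apply/fsubset_leq_card; rewrite fsubUset FS_mono ?fsubsetU1//=.
apply/fsubsetP=> _ /imfsetP[s /= + ->]; rewrite !inE => /andP[sB _].
rewrite addrC; apply: mem_FSU => //; first by rewrite fdisjoint1X.
exact/mem_FS/fset11.
Qed.

(** Enlarge a set [B] of [N] elements as long as each new element makes [FS B]
    grow by at least [c N] on average. The bound on [FS A] keeps [B] below
    [2 N] elements, and at the end every element of [A] outside [B] has escape at
    most [c N] from [FS B]. *)
Lemma exists_almost_periods A c N : (forall x, x \in A -> 0 < x) ->
    (3 * N <= #|` A|)%N -> (#|` FS A| <= c * N ^ 2)%N ->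
  exists E S, [/\ E `<=` A, (N <= #|` E|)%N, (N ^ 2 <= 2 * #|` S|)%N,
    (#|` S| <= c * N ^ 2)%N & forall e, e \in E -> (escape S e <= c * N)%N].
Proof.
move=> A0 NA cA.
have [B0 B0A B0N] : exists2 B, B `<=` A & #|` B| = N.
  by apply: exists_fsub_card; lia.
pose P B := B0 `<=` B /\ (#|` FS B0| + c * N * (#|` B| - N) <= #|` FS B|)%N.
have PB0 : P B0 by split=> //; rewrite B0N subnn muln0 addn0.
have [B [BA [B0B cB] Bmax]] := exists_max_fsub B0A PB0.
have FSB0 : (0 < #|` FS B0|)%N.
  by rewrite cardfs_gt0; apply/fset0Pn; exists 0; exact: FS0.
have FSBA : (#|` FS B| <= c * N ^ 2)%N.
  by apply: leq_trans cA; apply/fsubset_leq_card/FS_mono.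
have NB : (N <= #|` B|)%N by rewrite -B0N fsubset_leq_card.
have BN : (#|` B| <= 2 * N)%N.
  have : (c * N * (#|` B| - N) < c * N * N)%N by rewrite -[(_ * N * N)%N]mulnA mulnn; lia.
  by rewrite ltn_mul2l => /andP[_]; lia.
exists (A `\` B), (FS B); split=> //.
- exact: fsubsetDl.
- by rewrite cardfsDS//; lia.
- have B_pos x : x \in B -> 0 < x by move=> /(fsubsetP BA)/A0.
  apply: leq_trans (card_FS_ge B_pos); rewrite leq_exp2r//.
- move=> e; rewrite in_fsetD => /andP[eB eA]; rewrite leqNgt; apply/negP=> ce.
  have eBc : #|` e |` B| = #|` B|.+1 by rewrite cardfsU1 eB.
  have : (#|` e |` B| <= #|` B|)%N.
    apply: Bmax; first by rewrite fsubUset fsub1set eA.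
    split; first by apply: fsubset_trans B0B _; exact: fsubsetU1.
    rewrite eBc subSn// mulnS; have := card_FS_U1 eB; lia.
  by rewrite eBc ltnn.
Qed.

Lemma residue_inj_itv M : 0 < M ->
  {in [pred x | 0 < x <= M] &, injective (residue M)}.
Proof.
move=> M0 x y /andP[x0 xM] /andP[y0 yM] /residue_eqP-/(_ M0)[m e].
suff m0 : m = 0 by rewrite e m0 mulr0 addr0.
have m1 : (m%:~R : R) < 1%:~R.
  by rewrite -(ltr_pM2l M0) mulr1; lra.
have m2 : (-1)%:~R < (m%:~R : R).
  by rewrite -(ltr_pM2l M0) mulrN1; lra.
by move: m1 m2; rewrite !ltr_int; lia.
Qed.

(** Translating by [0, M, ..., (k - 1) M] spreads each residue of the ball of
    radius [k] over [k] points of the ball of radius [2 k]. *)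
Lemma card_ball_residue E M k : 0 < M -> M \in E ->
  (#|` residue M @` ball (symfset E) k| * k <= #|` ball (symfset E) (k + k)|)%N.
Proof.
move=> M0 ME; pose P := [fset M *+ i | i in iota 0 k].
have cP : #|` P| = k.
  rewrite /P -[RHS](size_iota 0) card_in_imfset /=.
    by rewrite undup_id ?iota_uniq.
  by move=> a b _ _; apply: mulrIn; rewrite gt_eqF.
rewrite -[X in (_ * X)%N]cP; apply: leq_trans (card_sumset_fibers _ _) _.
  move=> x _ /imfsetP[i _ ->]; rewrite -(residueDint x i%:Z M0).
  by rewrite -pmulrn mulr_natr.
apply/fsubset_leq_card/fsubsetP=> _ /sumsetP[x [_ [xB /imfsetP[i /= ik ->] ->]]].
apply: ballD => //; apply: ball_muln; first exact: symfset0.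
  exact: (fsubsetP (symfset_sub E)).
by move: ik; rewrite mem_iota; lia.
Qed.

(** The radius [2 j] is chosen so that every element of the ball spanned by [E]
    has escape at most [2 j c N = N^2 / 4 <= #|S| / 2]. The resulting bound on
    residues modulo the largest element [M] of [E] is incompatible with strict
    growth during [3 (16 c^2 + 1)] steps, whence a ball that is stable modulo
    [M] and [r = M / h], where [h] is its number of residues. *)
Lemma almost_periods_in_progression E S c j N :
    (forall x, x \in E -> 0 < x) ->
    (0 < c)%N -> (3 * (16 * c ^ 2).+1 <= j)%N -> N = (8 * c * j)%N ->
    (N <= #|` E|)%N -> (N ^ 2 <= 2 * #|` S|)%N -> (#|` S| <= c * N ^ 2)%N ->
    (forall e, e \in E -> (escape S e <= c * N)%N) ->
  exists2 r, 0 < r & forall e, e \in E ->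
    (exists m : int, e = r * m%:~R) /\ e <= r * (16 * c ^ 2 * N)%:R.
Proof.
move=> E0 c0 hj NE EN SN Sc Ee.
have j0 : (0 < j)%N by lia.
have N0 : (0 < N)%N by rewrite NE !muln_gt0 c0.
have [M ME Mmax] : exists2 a, a \in E & forall b, b \in E -> b <= a.
  by apply: exists_fset_max; rewrite -cardfs_gt0; lia.
have M0 := E0 M ME.
set U := symfset E; set f := residue M.
have U0 : 0 \in U := symfset0 E.
have ball2j : (#|` ball U (j + j)| <= 2 * #|` S|)%N.
  apply: card_almost_periods => [|x xB].
    apply/eqP=> S0; move: SN; rewrite S0 cardfs0 muln0 leqn0 expn_eq0; lia.
  rewrite -(@leq_pmul2l 2)//; apply: leq_trans SN; rewrite mulnA.
  rewrite (_ : N ^ 2 = 2 * 2 * ((j + j) * (c * N)))%N.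
    by rewrite leq_mul2l (escape_ball Ee xB).
  by rewrite -mulnn {1}NE; lia.
have ballj : (#|` f @` ball U j| <= 16 * c ^ 2 * N)%N.
  rewrite -(leq_pmul2r j0); apply: leq_trans (card_ball_residue _ M0 ME) _.
  apply: leq_trans ball2j _; rewrite (_ : 16 * c ^ 2 * N * j = 2 * (c * N ^ 2))%N.
    by rewrite leq_mul2l.
  by rewrite -[(N ^ 2)%N]mulnn {3}NE; lia.
have ballle l : (l <= j)%N -> (#|` f @` ball U l| <= 16 * c ^ 2 * N)%N.
  move=> lj; apply: leq_trans ballj; apply/fsubset_leq_card/subset_imfset.
  exact/fsubsetP/ball_le.
have [l lj stab] : exists2 l, (l <= j)%N & f @` ball U l.+1 `<=` f @` ball U l.
  apply: contrapT => nstab.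
  have : ((16 * c ^ 2).+1 * #|` E| <= 16 * c ^ 2 * N)%N.
    apply: leq_trans (ballle _ hj); apply: card_ball_growth => //.
    - by move=> x y z; apply: residueD.
    - by move=> u; exact: symfsetN.
    - exact: symfset_sub.
    - by move=> x y xE yE; apply: residue_inj_itv => //; rewrite inE E0 ?Mmax.
    - move=> l lj; apply/negP=> st; apply: nstab; exists l => //; lia.
  by move: EN N0; nia.
pose h := #|` f @` ball U l|.
have h0 : (0 < h)%N.
  rewrite cardfs_gt0; apply/fset0Pn; exists (f 0); apply/imfsetP; exists 0 => //=.
  by have := @ball_muln _ U l 0 0%N U0 U0 isT; rewrite mulr0n.
have hR : 0 < h%:R :> R by rewrite ltr0n.
exists (M / h%:R); first exact: divr_gt0.
move=> e eE; split.
  have [m hm] : exists m : int, e *+ h = M * m%:~R.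
    apply: residue_stable => // y yB; apply: (fsubsetP stab).
    apply: in_imfset; apply: mem_sumset => //; exact: (fsubsetP (symfset_sub E)).
  exists m; apply: (mulIf (lt0r_neq0 hR)); rewrite mulr_natr hm.
  by field; rewrite lt0r_neq0.
apply: le_trans (Mmax e eE) _.
have {1}-> : M = M / h%:R * h%:R by field; rewrite lt0r_neq0.
by apply: ler_wpM2l; [rewrite divr_ge0// ltW | rewrite ler_nat ballle].
Qed.

(** * Elements outside the progression *)

Lemma FS_multiples E r y : (forall e, e \in E -> exists m : int, e = r * m%:~R) ->
  y \in FS E -> exists m : int, y = r * m%:~R.
Proof.
move=> Er /FSP[B BE ->]; rewrite big_seq.
apply: (big_ind (fun y => exists m : int, y = r * m%:~R)).
- by exists 0; rewrite mulr0.
- by move=> _ _ [m ->] [k ->]; exists (m + k); rewrite intrD mulrDr.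
- by move=> x /(fsubsetP BE)/Er.
Qed.

(** Distinct classes of [FS X] modulo [r] give disjoint translates of [FS E], so
    there are at most [q] of them. Take [T] largest such that [FS T] has more
    classes than [T] has elements: no further element [x] can produce a new
    class, so translation by [x] permutes the classes of [FS T]. *)
Lemma complement_in_progression E X r q : 0 < r -> [disjoint E & X] ->
    (forall e, e \in E -> exists m : int, e = r * m%:~R) ->
    (#|` FS (E `|` X)| <= q * #|` FS E|)%N ->
  exists T h, [/\ T `<=` X, (#|` T| < q)%N, (0 < h <= q)%N &
    forall x, x \in X `\` T -> exists m : int, x *+ h = r * m%:~R].
Proof.
move=> r0 dEX Er qE; set f := residue r.
have FSE : (0 < #|` FS E|)%N.
  by rewrite cardfs_gt0; apply/fset0Pn; exists 0; exact: FS0.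
have classes T : T `<=` X -> (#|` f @` FS T| <= q)%N.
  move=> TX; rewrite -(leq_pmul2r FSE); apply: leq_trans qE.
  apply: leq_trans (card_sumset_fibers _ _) _.
    by move=> x y /(FS_multiples Er)[m ->]; exact: residueDint.
  have dTE : [disjoint T & E] by apply: (fdisjointWl TX); rewrite fdisjoint_sym.
  apply/fsubset_leq_card; apply: fsubset_trans (sumset_FS dTE) _.
  by rewrite fsetUC FS_mono// fsetUS.
pose P T : Prop := (#|` T| < #|` f @` FS T|)%N.
have P0 : P fset0.
  rewrite /P cardfs0 cardfs_gt0; apply/fset0Pn; exists (f 0).
  by apply: in_imfset; exact: FS0.
have [T [TX PT Tmax]] := exists_max_fsub (fsub0set X) P0.
exists T, #|` f @` FS T|; split=> //.
- exact: leq_trans PT (classes T TX).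
- by rewrite (leq_ltn_trans _ PT)//= classes.
move=> x; rewrite in_fsetD => /andP[xT xX].
apply: residue_stable => // y yT.
have sub : f @` FS T `<=` f @` FS (x |` T).
  by apply: subset_imfset; apply/fsubsetP/FS_mono/fsubsetU1.
have -> : residue r @` FS T = f @` FS (x |` T).
  apply/eqP; rewrite eqEfcard sub /=; apply: leq_trans PT.
  rewrite leqNgt; apply/negP => xP; have : (#|` x |` T| <= #|` T|)%N.
    by apply: Tmax; [rewrite fsubUset fsub1set xX | rewrite /P cardfsU1 xT].
  by rewrite cardfsU1 xT ltnn.
apply: in_imfset => /=; rewrite addrC; apply: mem_FSU => //.
  by rewrite fdisjoint1X.
exact/mem_FS/fset11.
Qed.

End Structure.

(** * The decomposition *)

Section Assembly.
Variable R : realType.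
Implicit Types (A B E F X Y T S : {fset R}) (r x y z D M : R).

Lemma few_large_bounded_small X D (k : nat) : 0 < D ->
    (forall x, x \in X -> 0 < x) -> \sum_(x <- X) Num.min x D <= k%:R * D ->
  (#|` [fset x in X | (D < x)%R]| <= k)%N /\
  \sum_(x <- [fset x in X | ~~ (D < x)]) x <= k%:R * D.
Proof.
move=> D0 X0; rewrite (big_fsetID _ (fun x => D < x)) /=.
have -> : \sum_(x <- [fset x in X | D < x]) Num.min x D =
          (#|` [fset x in X | (D < x)%R]|)%:R * D.
  rewrite card_fset_sum1 natr_sum big_distrl /= !big_seq; apply: eq_bigr => x.
  by rewrite mul1r !inE /= => /andP[_ /ltW/min_idPr].
have -> : \sum_(x <- [fset x in X | ~~ (D < x)]) Num.min x D =
          \sum_(x <- [fset x in X | ~~ (D < x)]) x.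
  rewrite !big_seq; apply: eq_bigr => x.
  by rewrite !inE /= -leNgt => /andP[_ /min_idPl].
set Y := [fset x in X | ~~ (D < x)]; set Z := [fset x in X | D < x] => H.
have Y0 : 0 <= \sum_(x <- Y) x.
  by apply: sum_fset_ge0 => x; rewrite !inE => /andP[/X0].
have Z0 : 0 <= (#|` Z|)%:R * D by rewrite mulr_ge0// ltW.
split; last by lra.
by rewrite -(ler_nat R) -(ler_pM2r D0); lra.
Qed.

(** In the bound on the sum, the factor [2 c] is the bound on [h] in the step
    [r / h] of the final progression, [4 c + 1] collects [E] and the small
    elements outside it, and the rest is the bound on the sum of [E] in units of
    [r]. *)
Lemma large_decomposition A c j N : (forall x, x \in A -> 0 < x) ->
    (0 < c)%N -> (3 * (16 * c ^ 2).+1 <= j)%N -> N = (8 * c * j)%N ->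
    (3 * N <= #|` A|)%N -> (#|` FS A| <= c * N ^ 2)%N ->
  exists A1 A2 r, [/\ A = A1 `|` A2, [disjoint A1 & A2], 0 < r,
    (forall x, x \in A1 -> exists m : int, x = r * m%:~R) &
    \sum_(x <- A1) x <= r * (2 * c * (4 * c).+1 * (16 * c ^ 2 * N * #|` A|))%:R /\
    (#|` A2| <= 6 * c)%N].
Proof.
move=> A0 c0 hj NE NA cA.
have [E [S [EA NcE NS cS Ee]]] := exists_almost_periods A0 NA cA.
have E0 x : x \in E -> 0 < x by move=> /(fsubsetP EA)/A0.
have [r r0 rE] := almost_periods_in_progression E0 c0 hj NE NcE NS cS Ee.
have Er e : e \in E -> exists m : int, e = r * m%:~R by case/rE.
have N0 : (0 < N)%N by rewrite NE !muln_gt0 c0; lia.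
set W := A `\` E.
have EW : E `|` W = A.
  by apply/fsetP=> x; rewrite !inE; case: (boolP (x \in E)) => //= /(fsubsetP EA)->.
have dEW : [disjoint E & W].
  by apply/fdisjointP=> x xE; rewrite !inE xE.
have FSE : (#|` FS (E `|` W)| <= 2 * c * #|` FS E|)%N.
  rewrite EW (mulnC 2) -mulnA; apply: leq_trans cA _; rewrite leq_pmul2l//.
  by apply: leq_trans (card_FS_ge E0); rewrite leq_exp2r.
have [T [h [TW Tc /andP[h0 hc] hX]]] := complement_in_progression r0 dEW Er FSE.
set X := W `\` T in hX.
have XA : X `<=` A by apply: fsubset_trans (fsubsetDl _ _) (fsubsetDl _ _).
have X0 x : x \in X -> 0 < x by move=> /(fsubsetP XA)/A0.
have EXA : E `|` X `<=` A by rewrite fsubUset EA.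
have dEX : [disjoint E & X] by apply/fdisjointP=> x xE; rewrite !inE xE /= andbF.
pose D : R := r * (16 * c ^ 2 * N * #|` A|)%:R.
have A_gt0 : (0 < #|` A|)%N by lia.
have D0 : 0 < D by rewrite mulr_gt0// ltr0n !muln_gt0 ?expn_gt0 c0 N0.
have ED : \sum_(x <- E) x <= D.
  apply: le_trans (_ : \sum_(x <- E) r * (16 * c ^ 2 * N)%:R <= _).
    by rewrite !big_seq; apply: ler_sum => x /rE[].
  rewrite big_const_seq count_predT iter_addr_0 /D -mulrnAr -mulrnA.
  by rewrite ler_pM2l// ler_nat leq_mul2l fsubset_leq_card// orbT.
have FS0 : 0 < (#|` FS E|)%:R :> R.
  by rewrite ltr0n cardfs_gt0; apply/fset0Pn; exists 0; exact: FS0.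
have mX : \sum_(x <- X) Num.min x D <= (4 * c)%:R * D.
  rewrite -(ler_pM2l FS0); apply: le_trans (card_FS_truncated_sum _ dEX ED) _.
    by move=> x /(fsubsetP EXA)/A0.
  have : (#|` FS (E `|` X)|)%:R <= (2 * c)%:R * (#|` FS E|)%:R :> R.
    rewrite -natrM ler_nat; apply: leq_trans FSE; apply/fsubset_leq_card/FS_mono.
    by rewrite EW.
  by move=> /(ler_wpM2l (ltW D0)); rewrite !natrM; lra.
have [Lc sY] := few_large_bounded_small D0 X0 mX.
set L := [fset x in X | D < x] in Lc; set Y := [fset x in X | ~~ (D < x)] in sY.
have hR : 0 < h%:R :> R by rewrite ltr0n.
exists (E `|` Y), (T `|` L), (r / h%:R); split.
- rewrite -EW; apply/fsetP=> x; rewrite !inE /=; case: (boolP (x \in E)) => //= xE.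
  case: (boolP (x \in T)) => [/(fsubsetP TW)|]; rewrite ?inE ?xE /= ?orbT//.
  by case: (x \in A) => //=; case: (D < x).
- apply/fdisjointP=> x; rewrite !inE /=.
  case: (boolP (x \in E)) => [xE _|xE /= /andP[/andP[xT _] /negbTE->]].
    rewrite /= andbF orbF; apply/negP => /(fsubsetP TW).
    by rewrite !inE xE.
  by rewrite (negbTE xT) /= andbF.
- exact: divr_gt0.
- move=> x; rewrite inE => /orP[/Er[m ->]|].
    exists (m * h%:Z); rewrite intrM /=; field; exact: lt0r_neq0.
  rewrite !inE /= => /andP[xX _].
  have [m xm] : exists m : int, x *+ h = r * m%:~R by apply: hX; rewrite !inE.
  exists m; apply: (mulIf (lt0r_neq0 hR)); rewrite mulr_natr xm.
  by field; exact: lt0r_neq0.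
split; last first.
  rewrite cardfsU; apply: leq_trans (leq_subr _ _) _.
  by rewrite (mulnDl 2 4); apply: leq_add Lc; exact: ltnW.
rewrite big_fsetU_disj; last first.
  by apply/fdisjointP=> x xE; rewrite !inE xE /= andbF.
have -> : r / h%:R * (2 * c * (4 * c).+1 * (16 * c ^ 2 * N * #|` A|))%:R =
    (2 * c)%:R / h%:R * ((4 * c).+1%:R * D) by rewrite !natrM /D; lra.
apply: le_trans (_ : (4 * c).+1%:R * D <= _).
  by rewrite -[(4 * c).+1]addn1 natrD; lra.
apply: ler_peMl; first by rewrite mulr_ge0// ltW.
by rewrite ler_pdivlMr// mul1r ler_nat.
Qed.

End Assembly.

Lemma sum_dilate (R : realType) (c : R) (A : {fset R}) : c != 0 ->
  \sum_(x \in dilate c [set` A]) x = c * \sum_(x <- A) x.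
Proof.
move=> c0; rewrite /dilate fsbig_image; last by move=> x y _ _; exact: mulfI.
by rewrite -fsbig_seq//= big_distrr.
Qed.

Local Open Scope classical_set_scope.
Local Open Scope ring_scope.

Theorem theorem1p2 (R : realType) (C : R) (hC : 0 < C) :
  exists2 K : R, 0 < K &
    forall (n : nat) (A : {fset R}),
      (0 < n)%N ->
      (forall x : R, x \in A -> 0 < x) ->
      #|` A| = n ->
      #|` FS A|%:R <= C * n%:R ^+ 2 ->
      exists A1 A2 : {fset R},
        [/\ A = (A1 `|` A2)%fset,
            [disjoint A1 & A2]%fset,
            (exists2 r : R, 0 < r &
               [set` A1] `<=` dilate r (pos_integers R) /\
               \sum_(x \in dilate r^-1 [set` A1]) x <= K * n%:R ^+ 2)
          & #|` A2|%:R <= K].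
Proof.
have [c0 c0_gt0 Cc0] : exists2 c0 : nat, (0 < c0)%N & C <= c0%:R.
  exists (Num.bound C).+1 => //.
  by apply/ltW/(lt_trans (archi_boundP (ltW hC))); rewrite ltr_nat.
(* 25 is the cost of replacing [n] by [N >= n / 5], a multiple of [8 c]. *)
have [c cE] : exists c, c = (25 * c0)%N by exists (25 * c0)%N.
have c_gt0 : (0 < c)%N by rewrite cE muln_gt0.
have c32 : (0 < 32 * c)%N by rewrite muln_gt0.
pose j0 := (3 * (16 * c ^ 2).+1)%N.
pose K := (32 * c * j0 + (6 * c + 2 * c * (4 * c).+1 * (16 * c ^ 2)))%N.
exists K%:R; first by rewrite ltr0n !addn_gt0 !muln_gt0 c_gt0.
move=> n A n0 A0 An FSA.
(* Below the threshold where the structure appears, all of [A] is exceptional. *)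
have [nsmall|nlarge] := ltnP n (32 * c * j0).
  exists fset0, A; split.
  - by rewrite fset0U.
  - exact: fdisjoint0X.
  - exists 1 => //; split; first by move=> x; rewrite /= in_fset0.
    rewrite sum_dilate ?invr_eq0 ?oner_eq0// big_seq_fset0.
    by rewrite mulr0 mulr_ge0 ?exprn_ge0.
  - by rewrite An ler_nat (leq_trans (ltnW nsmall))// leq_addr.
pose j := (n %/ (32 * c))%N; pose N := (8 * c * j)%N.
have j0j : (j0 <= j)%N by rewrite leq_divRL// mulnC.
have Nn : (4 * N <= n)%N.
  by rewrite (leq_trans _ (leq_divM n (32 * c)))// /N /j; lia.
have nN : (n <= 5 * N)%N.
  have : (n < j.+1 * (32 * c))%N by rewrite -ltn_divLR.
  have : (4 <= j)%N by apply: leq_trans j0j; rewrite /j0; lia.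
  rewrite /N; nia.
have cN : (#|` FS A| <= c * N ^ 2)%N.
  have : (#|` FS A| <= c0 * n ^ 2)%N.
    rewrite -(ler_nat R) natrM natrX; apply: le_trans FSA _.
    by rewrite ler_wpM2r ?exprn_ge0.
  move/leq_trans; apply; rewrite cE (mulnC 25) -mulnA leq_mul2l.
  by rewrite (_ : 25 * N ^ 2 = (5 * N) ^ 2)%N ?leq_exp2r ?nN ?orbT// expnMn.
have NA : (3 * N <= #|` A|)%N by rewrite An; lia.
have [A1 [A2 [r [AE dA r0 A1r [sA1 cA2]]]]] :=
  large_decomposition A0 c_gt0 j0j (erefl N) NA cN.
exists A1, A2; split=> //.
- exists r => //; split.
    move=> x /= xA1; have [m xm] := A1r x xA1.
    exists m%:~R; rewrite //= /pos_integers /=; exists m => //=.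
    have : 0 < x by apply: A0; rewrite AE inE xA1.
    by rewrite xm pmulr_rgt0// ltr0z.
  rewrite sum_dilate ?invr_eq0 ?gt_eqF// mulrC ler_pdivrMr//.
  apply: le_trans sA1 _; rewrite mulrC ler_pM2r// -natrX -natrM ler_nat An.
  rewrite /K; apply: leq_trans (_ : 2 * c * (4 * c).+1 * (16 * c ^ 2) * n ^ 2 <= _)%N.
    rewrite -[leqRHS]mulnA leq_mul2l -[(16 * _ * _ * _)%N]mulnA leq_mul2l.
    by rewrite -mulnn leq_mul2r; apply/orP; right; apply/orP; right; lia.
  by rewrite leq_mul2r; apply/orP; right; lia.
- rewrite ler_nat; apply: leq_trans cA2 _; rewrite /K; lia.
Qed.
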